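(* Let $f:\mathbb{R}^n\to\mathbb{R}$ be continuously differentiable and bounded below with $\nabla f$ Lipschitz continuous on $\mathbb{R}^n$, let $s$ be an integer with $0<s<n$, and let $\{\mathbf{x}^k\}$ be the sequence generated by the partial sparse-simplex method. Then any accumulation point $\mathbf{x}^*$ of $\{\mathbf{x}^k\}$ is an $L_2(f)$-stationary point of the problem (P): minimize $f(\mathbf{x})$ subject to $\|\mathbf{x}\|_0\le s$; i.e. $\nabla_i f(\mathbf{x}^* )=0$ for $i\in I_1(\mathbf{x}^* )$ and $|\nabla_i f(\mathbf{x}^* )|\le L_2(f)M_s(\mathbf{x}^* )$ for $i\in I_0(\mathbf{x}^* )$.
   Context: $\|\mathbf{x}\|_0$ is the number of nonzero components, $C_s=\{\mathbf{x}:\|\mathbf{x}\|_0\le s\}$, $I_1(\mathbf{x})=\{i:x_i\neq0\}$, $I_0(\mathbf{x})=\{i:x_i=0\}$, $M_s(\mathbf{x})$ the $s$-th largest absolute value among components of $\mathbf{x}$, $\mathbf{e}_i$ the $i$-th standard basis vector. For $i\neq j$, $\nabla_{i,j}f(\mathbf{x})\in\mathbb{R}^2$ is the vector of the $i$-th and $j$-th partial derivatives, $L_{i,j}(f)$ is a constant with $\|\nabla_{i,j}f(\mathbf{x})-\nabla_{i,j}f(\mathbf{x}+\mathbf{d})\|\le L_{i,j}(f)\|\mathbf{d}\|$ for all $\mathbf{x}$ and all $\mathbf{d}$ with at most two nonzero components, and $L_2(f)=\max_{i\neq j}L_{i,j}(f)$. Partial sparse-simplex method (all one-dimensional minima assumed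 attained): choose $\mathbf{x}^0\in C_s$. At step $k$: if $\|\mathbf{x}^k\|_0<s$, for each $i$ let $t_i\in\operatorname{argmin}_t f(\mathbf{x}^k+t\mathbf{e}_i)$, $f_i=\min_t f(\mathbf{x}^k+t\mathbf{e}_i)$, $i_k\in\operatorname{argmin}_i f_i$; if $f_{i_k}<f(\mathbf{x}^k)$ set $\mathbf{x}^{k+1}=\mathbf{x}^k+t_{i_k}\mathbf{e}_{i_k}$, else stop. If $\|\mathbf{x}^k\|_0=s$: for $i\in I_1(\mathbf{x}^k)$ let $f_i=\min_t f(\mathbf{x}^k+t\mathbf{e}_i)$; let $i_k^1\in\operatorname{argmin}\{f_i:i\in I_1(\mathbf{x}^k)\}$, $i_k^2\in\operatorname{argmax}\{|\nabla_i f(\mathbf{x}^k)|:i\in I_0(\mathbf{x}^k)\}$, $m_k\in\operatorname{argmin}\{|x_i^k|:i\in I_1(\mathbf{x}^k)\}$; let $D_k^1=\min_t f(\mathbf{x}^k+t\mathbf{e}_{i_k^1})$ with minimizer $T_k^1$, and $D_k^2=\min_t f(\mathbf{x}^k-x^k_{m_k}\mathbf{e}_{m_k}+t\mathbf{e}_{i_k^2})$ with minimizer $T_k^2$; if $D_k^1<D_k^2$ set $\mathbf{x}^{k+1}=\mathbf{x}^k+T_k^1\mathbf{e}_{i_k^1}$, else $\mathbf{x}^{k+1}=\mathbf{x}^k-x^k_{m_k}\mathbf{e}_{m_k}+T_k^2\mathbf{e}_{i_k^2}$. *)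

(* Defs.v *)
From HB Require Import structures.
From mathcomp Require Import all_boot all_order all_algebra.
From mathcomp Require Import all_classical all_reals all_analysis.
Set Implicit Arguments. Unset Strict Implicit. Unset Printing Implicit Defensive.
Import Order.TTheory GRing.Theory Num.Theory.
Import numFieldNormedType.Exports.
Local Open Scope ring_scope.

Section Defs.
Variables (R : realType) (n : nat).
Notation vec := 'rV[R]_n.

Definition ebasis (i : 'I_n) : vec := \row_j (if j == i then 1 else 0).

Definition I1 (x : vec) : {set 'I_n} := [set i | x ord0 i != 0].
Definition I0 (x : vec) : {set 'I_n} := [set i | x ord0 i == 0].
Definition l0 (x : vec) : nat := #|I1 x|.

Definition enorm (x : vec) : R := Num.sqrt (\sum_i (x ord0 i) ^+ 2).

Definition pgrad (f : vec -> R) (i : 'I_n) (x : vec) : R := 'd f x (ebasis i).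
Definition grad (f : vec -> R) (x : vec) : vec := \row_i pgrad f i x.

Definition Ms (s : nat) (x : vec) : R :=
  nth 0 (sort (fun a b : R => b <= a) [seq `|x ord0 i| | i <- enum 'I_n]) s.-1.

Definition is_min1 (f : vec -> R) (z : vec) (i : 'I_n) (t : R) : Prop :=
  forall t' : R, f (z + t *: ebasis i) <= f (z + t' *: ebasis i).

(* One iteration x = x^k  ~>  y = x^{k+1} of the partial sparse-simplex method.
   Termination ("else stop") is modelled by the sequence staying constant. *)
Definition pss_step (f : vec -> R) (s : nat) (x y : vec) : Prop :=
  ((l0 x < s)%N ->
    exists (ik : 'I_n) (tk : R),
      is_min1 f x ik tk /\
      (forall (j : 'I_n) (tj : R), is_min1 f x j tj ->
          f (x + tk *: ebasis ik) <= f (x + tj *: ebasis j)) /\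
      ((f (x + tk *: ebasis ik) < f x /\ y = x + tk *: ebasis ik) \/
       (f x <= f (x + tk *: ebasis ik) /\ y = x))) /\
  (l0 x = s ->
    exists (i1 i2 m : 'I_n) (T1 T2 : R),
      i1 \in I1 x /\ is_min1 f x i1 T1 /\
      (forall (j : 'I_n) (tj : R), j \in I1 x -> is_min1 f x j tj ->
          f (x + T1 *: ebasis i1) <= f (x + tj *: ebasis j)) /\
      i2 \in I0 x /\
      (forall j, j \in I0 x -> `|pgrad f j x| <= `|pgrad f i2 x|) /\
      m \in I1 x /\
      (forall j, j \in I1 x -> `|x ord0 m| <= `|x ord0 j|) /\
      is_min1 f (x - x ord0 m *: ebasis m) i2 T2 /\
      (let D1 := f (x + T1 *: ebasis i1) in
       let D2 := f (x - x ord0 m *: ebasis m + T2 *: ebasis i2) in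
       if D1 < D2 then y = x + T1 *: ebasis i1
       else y = x - x ord0 m *: ebasis m + T2 *: ebasis i2)).

Definition accumulation_point (xs : nat -> vec) (xstar : vec) : Prop :=
  forall eps : R, 0 < eps -> forall N : nat,
    exists k : nat, (N <= k)%N /\ enorm (xs k - xstar) < eps.

Definition block_lipschitz (f : vec -> R) (i j : 'I_n) (L : R) : Prop :=
  forall x d : vec, (l0 d <= 2)%N ->
    Num.sqrt ((pgrad f i x - pgrad f i (x + d)) ^+ 2
              + (pgrad f j x - pgrad f j (x + d)) ^+ 2) <= L * enorm d.

Definition L2 (Lij : 'I_n -> 'I_n -> R) : R :=
  \big[Num.max/0]_(ij : 'I_n * 'I_n | ij.1 != ij.2) Lij ij.1 ij.2.

End Defs.

(* Main.v *)
(* Monotonicity of f(x^k) gives f(xstar) <= f(x^{k+1}), so every one-dimensional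
   minimization made at step k bounds f(xstar) from above by f at a trial point
   built from x^k.  Since only finitely many choices of (support, leaving index m,
   entering index i) occur, and for a fixed choice these bounds are closed
   conditions on x^k, they hold at xstar itself for some choice.  At xstar they
   say that f cannot be decreased along any coordinate of the support (so these
   partial derivatives vanish), nor by zeroing xstar_m and moving along e_i; the
   descent lemma in the (m, i)-plane then bounds |grad_i f(xstar)| by
   L_{m,i} |xstar_m|, and |xstar_m| <= M_s(xstar). *)
Require Import Defs.
From HB Require Import structures.
From mathcomp Require Import all_boot all_order all_algebra.
From mathcomp Require Import all_classical all_reals all_analysis.
From mathcomp Require Import ring lra.
Import Order.TTheory GRing.Theory Num.Theory.
Import numFieldNormedType.Exports.
Local Open Scope ring_scope.

(** * Closed inequalities, the [s]-th largest entry and accumulation points *)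

Lemma closed_le_fun {R : realType} {T : topologicalType} {g h : T -> R} :
  continuous g -> continuous h -> closed [set x | g x <= h x]%classic.
Proof.
move=> cg ch.
have -> : [set x | g x <= h x]%classic
    = ((fun x => h x - g x) @^-1` [set y | 0 <= y])%classic.
  by apply/seteqP; split => x /=; rewrite subr_ge0.
apply: preimage_closed; last exact: closed_ge.
by move=> x _; apply: continuousB; [exact: ch|exact: cg].
Qed.

(** If the entry at index [s.-1] of the decreasing list were below [c], so would be all later ones,
    leaving at most [s.-1] entries that reach [c]. *)
Lemma nth_sort_ge {R : realType} (l : seq R) (s : nat) (c : R) :
  (0 < s)%N -> (s <= count (fun a => c <= a)%R l)%N ->
  c <= nth 0 (sort (fun a b : R => b <= a) l) s.-1.
Proof.
move=> s0; set r := sort _ l => sc.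
have tot : total (fun a b : R => b <= a) by move=> a b; exact: le_total.
have tr : transitive (fun a b : R => b <= a) by move=> a b d ab da; exact: le_trans da ab.
have rs : sorted (fun a b : R => b <= a) r by exact: sort_sorted.
have {}sc : (s <= count (fun a => c <= a)%R r)%N.
  by rewrite (permP (permEl (perm_sort _ l))).
have sr : (s <= size r)%N by exact: leq_trans sc (count_size _ _).
rewrite leNgt; apply/negP => ltc; move: sc.
rewrite -(cat_take_drop s.-1 r) count_cat leqNgt => /negP; apply.
have -> : count (fun a => c <= a) (drop s.-1 r) = 0%N.
  apply/eqP; rewrite -leqn0 leqNgt -has_count; apply/negP => /(has_nthP 0) [i].
  rewrite size_drop nth_drop => ilt; apply/negP; rewrite -ltNge.
  apply: le_lt_trans ltc.
  apply: (sorted_leq_nth tr (fun a => lexx a) 0 rs); rewrite ?inE.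
  - by rewrite prednK.
  - by move: ilt; rewrite ltn_subRL.
  - exact: leq_addr.
rewrite addn0; apply: (leq_ltn_trans (count_size _ _)).
by rewrite size_take prednK // sr prednK.
Qed.

Section Sparse.
Context {R : realType} {n : nat}.
Implicit Types (f : 'rV[R]_n -> R) (x y d : 'rV[R]_n) (A : {set 'I_n}) (i j m : 'I_n).

Lemma Ms_ge s x A c : (0 < s)%N -> #|A| = s ->
  (forall j, j \in A -> c <= `|x ord0 j|) -> c <= Ms s x.
Proof.
move=> s0 cS cx; apply: nth_sort_ge => //.
rewrite count_map -cS cardE.
rewrite -size_filter uniq_leq_size ?enum_uniq // => j; rewrite mem_enum => jS.
by rewrite mem_filter mem_enum /= cx.
Qed.

Lemma Ms_ge0 s x : (0 < s)%N -> (s <= n)%N -> 0 <= Ms s x.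
Proof.
move=> s0 sn; apply: nth_sort_ge => //.
rewrite count_map (eq_count (a2 := predT)) ?count_predT ?size_enum_ord //.
by move=> j /=; rewrite normr_ge0.
Qed.

Lemma abs_coord_le_enorm x j : `|x ord0 j| <= enorm x.
Proof.
rewrite -sqrtr_sqr ler_sqrt; last by apply: sumr_ge0 => i _; exact: sqr_ge0.
by rewrite (bigD1 j) //= lerDl sumr_ge0 // => i _; exact: sqr_ge0.
Qed.

Lemma accumulation_point_closed (xs : nat -> 'rV[R]_n) x
    (F : set 'rV[R]_n) (N : nat) :
  accumulation_point xs x -> closed F -> (forall k, (N <= k)%N -> F (xs k)) -> F x.
Proof.
move=> xsx clF Fxs; apply: clF => B /nbhs_ballP [e /= e0 eB].
have [k [Nk kx]] := xsx e e0 N.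
exists (xs k); split; first exact: Fxs.
(* Balls of row vectors are entrywise, so closeness in [enorm] is passed to each coordinate. *)
apply: eB; split => // i j; rewrite (ord1 i) /ball /= distrC.
apply: le_lt_trans kx; have := abs_coord_le_enorm (xs k - x) j.
by rewrite !mxE.
Qed.

Lemma continuous_coord_abs j : continuous (fun x : 'rV[R]_n => `|x ord0 j|).
Proof.
move=> x; apply: (continuous_comp (f := fun x : 'rV[R]_n => x ord0 j)).
  exact: coord_continuous.
exact: norm_continuous.
Qed.

(** * First-order optimality and the descent lemma in a coordinate plane *)

Lemma is_derive_line f x d (t : R) : (forall y, differentiable f y) ->
  is_derive t 1 (fun t => f (x + t *: d)) ('d f (x + t *: d) d).
Proof.
move=> df.
have dl : is_diff t (fun t : R => x + t *: d) (fun t => t *: d).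
  by apply: is_diff_eq; apply/funext => u; rewrite /= [LHS]add0r.
have dfl : is_diff (x + t *: d) f ('d f (x + t *: d)) by apply: DiffDef.
have dc := is_diff_comp dl dfl.
apply: DeriveDef; first by apply: diff_derivable; exact: ex_diff.
by rewrite deriveE ?diff_val /= ?scale1r //; exact: ex_diff.
Qed.

Lemma pgrad_line_min f x j : (forall y, differentiable f y) ->
  (forall t, f x <= f (x + t *: ebasis R j)) -> pgrad f j x = 0.
Proof.
move=> df xmin.
have := is_derive_line f x (ebasis R j) 0 df; rewrite scale0r addr0 => dj.
have d0 : is_derive (0 : R) 1 (fun t => f (x + t *: ebasis R j)) 0.
  apply: (@derive1_at_min _ _ (-1) 1 0).
  - lra.
  - by move=> t _; have [] := is_derive_line f x (ebasis R j) t df.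
  - by rewrite in_itv /=; apply/andP; split; lra.
  - by move=> t _; rewrite scale0r addr0.
by rewrite /pgrad -(@derive_val _ _ _ _ _ _ _ dj) (@derive_val _ _ _ _ _ _ _ d0).
Qed.

Lemma cauchy_schwarz2 (a b u v : R) :
  a * u + b * v <= Num.sqrt (u ^+ 2 + v ^+ 2) * Num.sqrt (a ^+ 2 + b ^+ 2).
Proof.
rewrite -sqrtrM; last by rewrite addr_ge0 ?sqr_ge0.
apply: le_trans (ler_norm _) _; rewrite -sqrtr_sqr ler_wsqrtr //.
(* By Lagrange's identity this square is the gap between the two sides. *)
by have := sqr_ge0 (a * v - b * u); nra.
Qed.

Lemma enorm_ebasis2 i j (a b : R) : i != j ->
  enorm (a *: ebasis R i + b *: ebasis R j) = Num.sqrt (a ^+ 2 + b ^+ 2).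
Proof.
move=> ij; congr Num.sqrt; rewrite (bigD1 i) //= (bigD1 j) 1?eq_sym //= big1.
  rewrite addr0 !mxE !eqxx (negPf ij) eq_sym (negPf ij).
  by rewrite !mulr1 !mulr0 add0r addr0.
move=> k /andP[ki kj]; rewrite !mxE (negPf ki) (negPf kj).
by rewrite !mulr0 addr0 expr0n.
Qed.

(** Subtracting the quadratic model along [d] from [f] gives [phi]; the Lipschitz bound makes its
    derivative nonpositive for [t >= 0], and the mean value theorem yields [phi 1 <= phi 0]. *)
Lemma block_descent f x i j a b L : (forall y, differentiable f y) ->
  i != j -> block_lipschitz f i j L ->
  f (x + (a *: ebasis R i + b *: ebasis R j)) <=
    f x + (a * pgrad f i x + b * pgrad f j x) + L / 2 * (a ^+ 2 + b ^+ 2).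
Proof.
move=> df ij fL; set d := a *: _ + _.
set p := a * _ + _; set q := a ^+ 2 + _.
pose g t := a * pgrad f i (x + t *: d) + b * pgrad f j (x + t *: d).
pose phi t := f (x + t *: d) - p * t - L / 2 * q * t ^+ 2.
have dphi (t : R) : is_derive t 1 phi (g t - p - L * q * t).
  have -> : phi = (fun t => f (x + t *: d)) - (p \*: id)
      - ((L / 2 * q) \*: (@id R ^+ 2)).
    by apply/funext => u.
  have dl := is_derive_line f x d t df.
  apply: is_derive_eq.
  rewrite [X in X - _ - _](_ : _ = g t).
    by rewrite /GRing.scale /=; lra.
  by rewrite linearD !linearZ.
have gle t : 0 <= t -> g t - p <= L * q * t.
  move=> t0.
  have cs := cauchy_schwarz2 (- a) (- b)
    (pgrad f i x - pgrad f i (x + t *: d)) (pgrad f j x - pgrad f j (x + t *: d)).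
  have regroup (u v u0 v0 : R) :
      a * u + b * v - (a * u0 + b * v0) = - a * (u0 - u) + - b * (v0 - v) by ring.
  rewrite -regroup !sqrrN in cs.
  apply: le_trans cs _.
  have l0d : (l0 (t *: d) <= 2)%N.
    apply: (@leq_trans #|[set i; j]|); last by rewrite cards2 ij.
    apply: subset_leq_card; apply/fintype.subsetP => k; rewrite !inE; apply: contraNT.
    rewrite negb_or => /andP[ki kj].
    by rewrite !mxE (negPf ki) (negPf kj) !mulr0 addr0 mulr0.
  have := fL x (t *: d) l0d.
  have -> : t *: d = (t * a) *: ebasis R i + (t * b) *: ebasis R j.
    by rewrite scalerDr !scalerA.
  rewrite enorm_ebasis2 // -scalerA -[(t * b) *: _]scalerA -scalerDr -/d.
  rewrite !exprMn -mulrDr -/q sqrtrM ?sqr_ge0 // sqrtr_sqr ger0_norm //.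
  move=> h.
  (* One factor [Num.sqrt q] is the norm of [d], the other comes from Cauchy-Schwarz. *)
  rewrite (_ : L * q * t = L * (t * Num.sqrt q) * Num.sqrt q); last first.
    by rewrite -[in LHS](sqr_sqrtr (_ : 0 <= q)) ?addr_ge0 ?sqr_ge0 //; ring.
  by rewrite ler_wpM2r ?sqrtr_ge0.
have cphi : {within `[0, 1], continuous phi}%classic.
  apply: continuous_subspaceT => t; apply: differentiable_continuous.
  by apply/derivable1_diffP; have [] := dphi t.
have [t t01] := @MVT _ phi _ 0 1 ltr01 (fun t _ => dphi t) cphi.
have t0 : 0 <= t by move: t01; rewrite in_itv /= => /andP[/ltW].
have := gle t t0; rewrite /phi scale1r scale0r addr0; lra.
Qed.

(** * Closed zones recording the choices of a step *)

(* [(A, m, i)] = (support, index leaving, index entering) is kept fixed so that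
   the condition on [x] is closed; [None] stands for iterates with fewer than
   [s] nonzero entries. *)
Definition step_zone f (c : R) (p : option ({set 'I_n} * 'I_n * 'I_n)) :
    set 'rV[R]_n :=
  match p with
  | None => [set x : 'rV[R]_n | forall j t, c <= f (x + t *: ebasis R j)]%classic
  | Some (A, m, i) => [set x : 'rV[R]_n |
      [/\ forall j, j \notin A -> `|x ord0 j| <= 0,
          forall j, j \in A -> `|x ord0 m| <= `|x ord0 j|,
          forall j, j \notin A -> `|pgrad f j x| <= `|pgrad f i x|,
          forall j, j \in A -> forall t, c <= f (x + t *: ebasis R j)
        & forall t, c <= f (x - x ord0 m *: ebasis R m + t *: ebasis R i)]]%classic
  end.

(** These conditions do not involve the iterate, so they need no passage to the limit. *)
Definition admissible s (p : option ({set 'I_n} * 'I_n * 'I_n)) :=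
  if p is Some (A, m, i) then [&& #|A| == s, m \in A & i \notin A] else true.

(** For fixed [j] and [t] each clause is a weak inequality between continuous functions, vanishing
    being written as [<= 0]. *)
Lemma closed_step_zone f c p : continuous f ->
  (forall i, continuous (pgrad f i)) -> closed (step_zone f c p).
Proof.
move=> cf cg.
have ct j t : continuous (fun x => f (x + t *: ebasis R j)).
  move=> x; apply: (continuous_comp (f := fun x => x + t *: ebasis R j)).
    by apply: continuousD; [exact: cvg_id|exact: cst_continuous].
  exact: cf.
have cs m i t :
    continuous (fun x => f (x - x ord0 m *: ebasis R m + t *: ebasis R i)).
  move=> x.
  apply: (continuous_comp
    (f := fun x => x - x ord0 m *: ebasis R m + t *: ebasis R i)); last exact: cf.
  apply: continuousD; last exact: cst_continuous.
  apply: continuousB; first exact: cvg_id.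
  by apply: continuousZl; exact: coord_continuous.
have ca i : continuous (fun x => `|pgrad f i x|).
  move=> x; apply: (continuous_comp (f := pgrad f i)); first exact: cg.
  exact: norm_continuous.
move=> x clx.
have sub (g h : 'rV[R]_n -> R) : continuous g -> continuous h ->
    (forall y, step_zone f c p y -> g y <= h y) -> g x <= h x.
  move=> cg' ch' gh; have cl := closed_le_fun cg' ch'.
  by apply: (cl x); exact: closureS clx.
case: p clx sub => [[[A m] i]|] clx sub /=.
  split=> [j jS|j jS|j jS|j jS t|t].
  - apply: (sub _ (fun=> 0) (continuous_coord_abs j) (@cst_continuous _ _ 0)) => y [+ _ _ _ _]; exact.
  - apply: (sub _ _ (continuous_coord_abs m) (continuous_coord_abs j)) => y [_ + _ _ _].
    exact.
  - by apply: (sub _ _ (ca j) (ca i)) => y [_ _ + _ _]; exact.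
  - by apply: (sub (fun=> c) _ (@cst_continuous _ _ c) (ct j t)) => y [_ _ _ + _]; exact.
  - by apply: (sub (fun=> c) _ (@cst_continuous _ _ c) (cs m i t)) => y [_ _ _ _].
move=> j t; by apply: (sub (fun=> c) _ (@cst_continuous _ _ c) (ct j t)) => y; exact.
Qed.

(** * Feasibility, descent and zone membership for one step *)

Lemma I1_addZ x t i : I1 (x + t *: ebasis R i) \subset i |: I1 x.
Proof.
apply/fintype.subsetP => k; rewrite !inE; apply: contraNT; rewrite negb_or negbK.
by move=> /andP[ki /eqP xk]; rewrite !mxE (negPf ki) mulr0 addr0 xk.
Qed.

Lemma I1_zero_coord x m : I1 (x - x ord0 m *: ebasis R m) \subset I1 x :\ m.
Proof.
apply/fintype.subsetP => k; rewrite !inE; apply: contraNT; rewrite negb_and !negbK.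
case: (eqVneq k m) => [-> _|km /= /eqP xk]; first by rewrite !mxE eqxx mulr1 subrr.
by rewrite !mxE (negPf km) mulr0 subr0 xk.
Qed.

Lemma is_min1_le f x i t : is_min1 f x i t -> f (x + t *: ebasis R i) <= f x.
Proof. by move=> /(_ 0); rewrite scale0r addr0. Qed.

Lemma pss_step_l0 f s x y :
  (l0 x <= s)%N -> pss_step f s x y -> (l0 y <= s)%N.
Proof.
rewrite leq_eqVlt => /orP[/eqP xs [_ /(_ xs)]|xs [/(_ xs) + _]].
  move=> [i1 [i2 [m [T1 [T2 [i1x [_ [_ [i2x [_ [mx [_ [_]]]]]]]]]]]]] /=.
  case: ifP => _ ->.
    rewrite -xs; apply: subset_leq_card; apply: (fintype.subset_trans (I1_addZ _ _ _)).
    by rewrite finset.subUset finset.sub1set i1x subxx.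
  apply: (leq_trans (subset_leq_card (I1_addZ _ _ _))).
  apply: (leq_trans (leq_card_setU _ _).1); rewrite cards1.
  apply: leq_ltn_trans (subset_leq_card (I1_zero_coord x m)) _.
  by rewrite -xs /l0 (cardsD1 m (I1 x)) mx.
move=> [ik [tk [_ [_ [[_ ->]|[_ ->]]]]]]; last exact: ltnW.
apply: (leq_trans (subset_leq_card (I1_addZ _ _ _))).
by apply: (leq_trans (leq_card_setU _ _).1); rewrite cards1.
Qed.

Lemma pss_step_le f s x y : (l0 x <= s)%N -> pss_step f s x y -> f y <= f x.
Proof.
rewrite leq_eqVlt => /orP[/eqP xs [_ /(_ xs)]|xs [/(_ xs) + _]].
  move=> [i1 [i2 [m [T1 [T2 [_ [/is_min1_le fT1 [_ [_ [_ [_ [_ [_]]]]]]]]]]]]] /=.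
  by case: ltP => [_|D21] -> //; exact: le_trans fT1.
by move=> [ik [tk [/is_min1_le ftk [_ [[_ ->]|[_ ->]]]]]].
Qed.

Lemma pss_step_zone f s c x y :
  (forall z i, exists t, is_min1 f z i t) ->
  (l0 x <= s)%N -> pss_step f s x y -> c <= f y ->
  exists2 p, admissible s p & step_zone f c p x.
Proof.
move=> attained.
rewrite leq_eqVlt => /orP[/eqP xs [_ /(_ xs)]|xs [/(_ xs) + _]].
  move=> [i1 [i2 [m [T1 [T2 [i1x [_ [min1 [i2x [max2 [mx [minm [min2]]]]]]]]]]]]].
  move=> /= ydef cy.
  (* [f y] is the smaller of the two trial values, so [c] is below both. *)
  have [cD1 cD2] : c <= f (x + T1 *: ebasis R i1) /\
      c <= f (x - x ord0 m *: ebasis R m + T2 *: ebasis R i2).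
    move: ydef cy; case: ltP => D12 -> cy; split=> //.
      exact: le_trans (ltW D12).
    exact: le_trans D12.
  have I0E j : (j \in I0 x) = (j \notin I1 x) by rewrite !inE negbK.
  exists (Some (I1 x, m, i2)); first by rewrite /= -xs eqxx mx -I0E i2x.
  split=> [j|j|j|j jx t|t].
  - by rewrite -I0E inE => /eqP ->; rewrite normr0.
  - exact: minm.
  - by rewrite -I0E; exact: max2.
  (* [min1] compares minimizers only; an arbitrary [t] is reached through [tj]. *)
  - have [tj minj] := attained x j.
    exact: le_trans cD1 (le_trans (min1 j tj jx minj) (minj t)).
  - exact: le_trans cD2 (min2 t).
move=> [ik [tk [mink [mini ydef]]]] cy; exists None => //= j t.
have [tj minj] := attained x j.
apply: le_trans (le_trans (mini j tj minj) (minj t)).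
(* If the method stops, [f x] itself is at most the best trial value. *)
case: ydef cy => [[_ ->] //|[fx ->] cx]; exact: le_trans fx.
Qed.

(** * Stationarity from zone membership *)

Lemma le_L2 (Lij : 'I_n -> 'I_n -> R) i j : i != j -> Lij i j <= L2 Lij.
Proof.
move=> ij.
exact: (@le_bigmax_cond _ _ _ _ (i, j) _ (fun ij => Lij ij.1 ij.2)).
Qed.

Lemma L2_ge0 (Lij : 'I_n -> 'I_n -> R) : 0 <= L2 Lij.
Proof. exact: bigmax_ge_id. Qed.

(* Compares [x] with the point obtained by moving the weight of coordinate [m]
   to coordinate [i], with the sign that decreases [f] at first order. *)
Lemma pgrad_swap_le f x m i L : (forall y, differentiable f y) ->
  m != i -> block_lipschitz f m i L -> pgrad f m x = 0 ->
  (forall t, f x <= f (x - x ord0 m *: ebasis R m + t *: ebasis R i)) ->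
  `|pgrad f i x| <= L * `|x ord0 m|.
Proof.
move=> df mi fL gm swap; set a := x ord0 m in swap *; set g := pgrad f i x.
(* With [a = 0] the swap is a pure move along coordinate [i], on which [x] is then minimal. *)
have [a0|a0] := eqVneq a 0.
  rewrite a0 normr0 mulr0 normr_le0 /g; apply/eqP; apply: pgrad_line_min => // t.
  by have := swap t; rewrite a0 scale0r subr0.
pose e : R := (-1) ^+ (g < 0)%R.
have := block_descent f x m i (- a) (- (e * `|a|)) L df mi fL.
rewrite scaleNr addrA gm mulr0 add0r -/g => /(le_trans (swap _)).
have -> : - (e * `|a|) * g = - (`|g| * `|a|) by rewrite [`|g|]normrEsign -/e; ring.
rewrite !sqrrN exprMn sqrr_sign mul1r -[a ^+ 2]real_normK ?num_real // => h.
(* The quadratic term equals [L] times the square of [|a|]; one factor [|a|] cancels. *)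
have a_gt0 : 0 < `|a| by rewrite normr_gt0.
rewrite -(ler_pM2r a_gt0); lra.
Qed.

Lemma step_zone_stationary f (Lij : 'I_n -> 'I_n -> R) s x p :
  (forall y, differentiable f y) ->
  (forall i j, i != j -> block_lipschitz f i j (Lij i j)) ->
  (0 < s)%N -> (s <= n)%N -> admissible s p -> step_zone f (f x) p x ->
  (forall i, i \in I1 x -> pgrad f i x = 0) /\
  (forall i, i \in I0 x -> `|pgrad f i x| <= L2 Lij * Ms s x).
Proof.
move=> df fL s0 sn.
have rhs0 : 0 <= L2 Lij * Ms s x by rewrite mulr_ge0 ?L2_ge0 ?Ms_ge0.
case: p => [[[A m] i] /and3P[/eqP cS mS iS] [x0 xm gi gS swap]|_ /= g0].
  have gS0 j : j \in A -> pgrad f j x = 0.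
    by move=> jS; apply: pgrad_line_min => //; exact: gS.
  have mi : m != i by apply: contraNneq iS => <-.
  split=> [j|j _].
    rewrite inE => xj; apply: gS0; apply: contraNT xj => /x0.
    by rewrite normr_le0.
  (* Coordinates in [A] may vanish at [x], so a zero coordinate can still lie in [A]. *)
  have [/gS0 ->|/gi gji] := boolP (j \in A); first by rewrite normr0.
  have := pgrad_swap_le f x m i _ df mi (fL _ _ mi) (gS0 _ mS) swap.
  move=> /(le_trans gji) /le_trans; apply.
  apply: (@le_trans _ _ (L2 Lij * `|x ord0 m|)).
    by rewrite ler_wpM2r // le_L2.
  by rewrite ler_wpM2l ?L2_ge0 // (Ms_ge s x A).
have gj0 j : pgrad f j x = 0 by apply: pgrad_line_min => //; exact: g0.
by split=> j _; rewrite gj0 // normr0.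
Qed.

End Sparse.

Theorem theorem3p4 (R : realType) (n s : nat) (f : 'rV[R]_n -> R)
  (Lij : 'I_n -> 'I_n -> R) (xs : nat -> 'rV[R]_n) (xstar : 'rV[R]_n) :
  (* f continuously differentiable *)
  (forall x, differentiable f x) ->
  (forall i : 'I_n, continuous (pgrad f i)) ->
  (* f bounded below *)
  (exists b : R, forall x, b <= f x) ->
  (* grad f Lipschitz continuous *)
  (exists L : R, forall x y, enorm (grad f x - grad f y) <= L * enorm (x - y)) ->
  (* 0 < s < n *)
  (0 < s)%N -> (s < n)%N ->
  (* all one-dimensional minima are attained *)
  (forall (z : 'rV[R]_n) (i : 'I_n), exists t : R, is_min1 f z i t) ->
  (* the constants L_{i,j}(f) *)
  (forall i j : 'I_n, i != j -> block_lipschitz f i j (Lij i j)) ->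
  (* xs generated by the partial sparse-simplex method *)
  (l0 (xs 0%N) <= s)%N ->
  (forall k : nat, pss_step f s (xs k) (xs k.+1)) ->
  accumulation_point xs xstar ->
  (* L_2(f)-stationarity *)
  (forall i : 'I_n, i \in I1 xstar -> pgrad f i xstar = 0) /\
  (forall i : 'I_n, i \in I0 xstar -> `|pgrad f i xstar| <= L2 Lij * Ms s xstar).
Proof.
move=> df cg _ _ s0 sn attained fL x0s steps acc.
have cf : continuous f by move=> x; exact: differentiable_continuous.
have l0s k : (l0 (xs k) <= s)%N.
  by elim: k => // k ih; exact: pss_step_l0 ih (steps k).
have noninc : {homo (f \o xs) : m k / (m <= k)%N >-> k <= m}.
  apply: homo_leq => [x|y x z yx zy|k] /=; [exact: lexx|exact: le_trans zy yx|].
  exact: pss_step_le (l0s k) (steps k).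
have fxs k : f xstar <= f (xs k).
  apply: (accumulation_point_closed xs xstar [set x | f x <= f (xs k)]%classic k acc).
    by apply: closed_le_fun => //; exact: cst_continuous.
  by move=> j kj; exact: noninc.
(* A finite union of closed zones is closed, which replaces extracting a subsequence with constant
   choices. *)
have : (\bigcup_(p in [set` admissible s]) step_zone f (f xstar) p)%classic xstar.
  apply: (accumulation_point_closed xs xstar _ 0 acc) => [|k _].
    apply: closed_bigcup => [|p _]; last exact: closed_step_zone.
    exact: finite_finset.
  have [p ps px] := pss_step_zone f s _ _ _ attained (l0s k) (steps k) (fxs k.+1).
  by exists p.
move=> [p ps px]; exact: step_zone_stationary df fL s0 (ltnW sn) ps px.
Qed.
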